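(* Each distributive solution $(X,\sigma,\tau)$ is a disjoint union, over a set $I$, of abelian groups $A_j=\langle\{a_{i,j}\mid i\in I\}\rangle$, $j\in I$, with $$\sigma_x(y)=y+a_{i,j}\quad\text{and}\quad \tau_y(x)=x-a_{j,i}$$ for all $i,j\in I$, $x\in A_i$ and $y\in A_j$. That is, there exist a set $I$, a partition $X=\bigsqcup_{j\in I}A_j$ into non-empty subsets, an abelian group structure on each $A_j$, and elements $a_{i,j}\in A_j$ ($i,j\in I$) such that each $A_j$ is generated by $\{a_{i,j}\mid i\in I\}$ and the displayed formulas hold.
   Context: A solution is a triple $(X,\sigma,\tau)$ with $X$ a set of arbitrary cardinality and $\sigma,\tau\colon X\times X\to X$. Write $\sigma_x=\sigma(x,\cdot)$, $\tau_y=\tau(\cdot,y)$ and $r(x,y)=(\sigma_x(y),\tau_y(x))$. It is required that: (braid relation) $(\mathrm{id}\times r)(r\times \mathrm{id})(\mathrm{id}\times r)=(r\times \mathrm{id})(\mathrm{id}\times r)(r\times \mathrm{id})$ on $X^3$; (non-degenerate) all $\sigma_x$ and $\tau_y$ are bijections of $X$; (involutive) $r^2=\mathrm{id}_{X^2}$. Write $x\circ y=\sigma_x(y)$ and $x\bullet y=\tau_y(x)$. A solution is distributive if $x\circ(y\circ z)=(x\circ y)\circ(x\circ z)$ and $(y\bullet z)\bullet x=(y\bullet x)\bullet(z\bullet x)$ for all $x,y,z\in X$. *)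

(* Defs.v *)
From mathcomp Require Import all_boot all_algebra.
From mathcomp Require Import boolp classical_sets.

Set Implicit Arguments.
Unset Strict Implicit.
Unset Printing Implicit Defensive.

Import GRing.Theory.
Local Open Scope classical_set_scope.
Local Open Scope ring_scope.

Section Solutions.
Variable X : Type.

(* Maps X * X -> X are curried with the arguments in their written order:     *)
(* [sigma x y] is sigma_x(y) and [tau x y] is tau_y(x), so that tau_y is      *)
(* [tau^~ y].                                                                 *)
Variables sigma tau : X -> X -> X.

Definition rmap (p : X * X) : X * X := (sigma p.1 p.2, tau p.1 p.2).

Definition rmap_id (t : X * X * X) : X * X * X := (rmap t.1, t.2).

Definition id_rmap (t : X * X * X) : X * X * X :=
  let q := rmap (t.1.2, t.2) in (t.1.1, q.1, q.2).

Definition braided : Prop :=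
  id_rmap \o rmap_id \o id_rmap =1 rmap_id \o id_rmap \o rmap_id.

Definition nondegenerate : Prop :=
  (forall x, bijective (sigma x)) /\ (forall y, bijective (tau^~ y)).

Definition is_solution : Prop :=
  [/\ braided, nondegenerate & involutive rmap].

(* With x o y = sigma_x(y) = sigma x y and x * y = tau_y(x) = tau x y, these  *)
(* are the left distributivity of o and the right distributivity of *.        *)
Definition is_distributive : Prop :=
  (forall x y z, sigma x (sigma y z) = sigma (sigma x y) (sigma x z)) /\
  (forall x y z, tau (tau y z) x = tau (tau y x) (tau z x)).

End Solutions.

(* The abelian group with carrier T given by a group structure g on T; it     *)
(* allows one to quantify over the abelian group structures on a fixed type,  *)
(* such as the type of elements of a set.                                     *)
Definition zmod_of (T : Type) (g : GRing.Zmodule T) : zmodType :=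
  GRing.Zmodule.Pack g.

Definition subgroup_generated (V : zmodType) (S : set V) : set V :=
  smallest (fun H : set V => GRing.zmod_closed [in H]) S.

(* Main.v *)
Require Import Defs.
From HB Require Import structures.
From mathcomp Require Import all_boot all_algebra.
From mathcomp Require Import boolp classical_sets.

Local Open Scope classical_set_scope.
Local Open Scope ring_scope.

(** Comparing distributivity with the braid relation, and cancelling, gives
    sigma_(tau_y(x)) = sigma_x and tau_(sigma_z(x)) = tau_x.  Involutivity then
    forces tau_x to be the inverse of sigma_x ([sigmaK], [tauK]), so sigma_x
    depends only on the orbit of x under the group generated by all the
    sigma_z; with that invariance, distributivity says exactly that the
    sigma_z commute ([sigma_comm]).

    Hence this group (the [displacement] maps) is abelian and permutes each of
    its orbits transitively.  A transitive abelian permutation group is regular,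
    so the choice of a base point e transports its group law to the orbit, and
    every displacement f becomes the translation by f(e)
    ([regular_action_zmodule]).  The A_j are the orbits, and a_(i,j) is
    sigma_x(e_j) for any x in A_i.  These elements generate A_j because a
    displacement is a composite of translations by them and their
    opposites. *)

Import GRing.Theory.

(** The sum of x and y is h_x(y), where h_x is a member of [M] that sends e to
    x.  Commutation makes the choice of h_x immaterial: two members of [M] that
    agree at e agree everywhere, since every point is h(e) for some h in [M].
    Commutativity and associativity of the sum come from commutation alone, and
    a point that h_x sends to e is the opposite of x. *)
Lemma regular_action_zmodule (T : Type) (e : T) (M : set (T -> T)) :
    (forall f h x, M f -> M h -> f (h x) = h (f x)) ->
    (forall x, exists2 f, M f & f e = x) ->
    (forall f, M f -> exists x, f x = e) ->
  exists g : GRing.Zmodule T,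
    (0 : zmod_of g) = e /\
    forall f x, M f -> f x = (x : zmod_of g) + (f e : zmod_of g).
Proof.
move=> MC Mtrans Monto.
have hE x : exists f, M f /\ f e = x.
  by have [f Mf fe] := Mtrans x; exists f.
have [h hP] := choice hE.
have hM x : M (h x) by case: (hP x).
have he x : h x e = x by case: (hP x).
have [opp oppP] := choice (fun x => Monto (h x) (hM x)).
have hC x y : h x y = h y x by rewrite -{1}(he y) MC // he.
have hA : associative h.
  by move=> x y z; rewrite (hC y z) [RHS]hC MC.
have h0 : left_id e h by move=> x; rewrite hC he.
have hN : left_inverse e opp h by move=> x; rewrite hC oppP.
pose C : choiceType :=
  HB.pack_for choiceType T (gen_eqMixin T) (gen_choiceMixin T).
pose V : zmodType := HB.pack_for zmodType C
  (GRing.isZmodule.Build C hA hC h0 hN).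
exists (GRing.Zmodule.class V); split=> // f x Mf.
by change (f x = h x (f e)); rewrite (MC (h x)) // he.
Qed.

Section DistributiveSolution.

Set Implicit Arguments.
Unset Strict Implicit.

Variables (X : Type) (sigma tau : X -> X -> X).
Hypotheses (hsol : is_solution sigma tau) (hdist : is_distributive sigma tau).

(** The braid relation reads sigma_x sigma_y = sigma_(sigma_x(y)) sigma_(tau_y(x))
    and left distributivity reads sigma_x sigma_y = sigma_(sigma_x(y)) sigma_x. *)
Lemma sigma_tau x y : sigma (tau x y) = sigma x.
Proof.
case: hsol hdist => br [sbij _] _ [sdist _]; apply: funext => z.
apply: (bij_inj (sbij (sigma x y))); rewrite -sdist.
by have /(congr1 (fun t => t.1.1)) := br (x, y, z).
Qed.

Lemma tau_sigma x y z : tau z (sigma x y) = tau z y.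
Proof.
case: hsol hdist => br [_ tbij] _ [_ tdist].
apply: (bij_inj (tbij (tau x y))) => /=; rewrite -tdist.
by have /(congr1 snd) := br (z, x, y).
Qed.

(** Involutivity gives tau_(x')(sigma_x(y)) = y with x' = tau_y(x).  Here
    sigma_x = sigma_(x'), and x' is arbitrary because tau_y is onto. *)
Lemma sigmaK x y : tau (sigma x y) x = y.
Proof.
case: hsol => _ [_ tbij] rK; have [u _ uK] := tbij y.
rewrite -(uK x) /= sigma_tau.
by have /(congr1 snd) := rK (u x, y).
Qed.

Lemma tauK x y : sigma x (tau y x) = y.
Proof.
case: hsol => _ [_ tbij] _.
by apply: (bij_inj (tbij x)); rewrite sigmaK.
Qed.

Lemma sigma_sigma x y : sigma (sigma x y) = sigma y.
Proof.
by apply: funext => z; rewrite -{1}(sigmaK y z) -(tau_sigma x) tauK.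
Qed.

Lemma sigma_comm x y z : sigma x (sigma y z) = sigma y (sigma x z).
Proof. by case: hdist => -> _; rewrite sigma_sigma. Qed.

Inductive displacement : (X -> X) -> Prop :=
| displacement_id : displacement id
| displacement_sigma x : displacement (sigma x)
| displacement_tau x : displacement (tau^~ x)
| displacement_comp f h :
    displacement f -> displacement h -> displacement (f \o h).

(** Since tau_x is the inverse of sigma_x, whatever commutes with one commutes
    with the other. *)
Lemma tau_comm_of_sigma (f : X -> X) x :
  (forall z, f (sigma x z) = sigma x (f z)) ->
  forall z, f (tau z x) = tau (f z) x.
Proof. by move=> fC z; rewrite -{2}(tauK x z) fC sigmaK. Qed.

Lemma displacement_comm f h x :
  displacement f -> displacement h -> f (h x) = h (f x).
Proof.
have sC k y z : displacement k -> sigma y (k z) = k (sigma y z).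
  move=> dk; elim: dk z => //= [w z|w z|k1 k2 _ IH1 _ IH2 z].
  - exact: sigma_comm.
  - by apply: tau_comm_of_sigma => t; exact: sigma_comm.
  - by rewrite IH1 IH2.
move=> df dh; elim: df x => //= [y z|y z|f1 f2 _ IH1 _ IH2 z].
- exact: sC.
- by rewrite (@tau_comm_of_sigma h) // => t; rewrite sC.
- by rewrite IH2 IH1.
Qed.

Lemma displacement_inv f :
  displacement f -> exists2 h, displacement h & cancel f h.
Proof.
elim=> [|x|x|f1 f2 _ [h1 d1 K1] _ [h2 d2 K2]].
- by exists id => //; exact: displacement_id.
- by exists (tau^~ x); [exact: displacement_tau | exact: sigmaK].
- by exists (sigma x); [exact: displacement_sigma | move=> y; exact: tauK].
- by exists (h2 \o h1); [exact: displacement_comp | exact: can_comp].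
Qed.

Lemma sigma_displacement f x : displacement f -> sigma (f x) = sigma x.
Proof.
move=> df; elim: df x => //= [y z|y z|f1 f2 _ IH1 _ IH2 z].
- exact: sigma_sigma.
- exact: sigma_tau.
- by rewrite IH1 IH2.
Qed.

Definition orbit (e : X) : set X := [set y | exists2 f, displacement f & f e = y].

Lemma orbit_refl e : orbit e e.
Proof. by exists id => //; exact: displacement_id. Qed.

Lemma orbit_displacement e f x : displacement f -> orbit e x -> orbit e (f x).
Proof.
move=> df [h dh <-]; exists (f \o h) => //; exact: displacement_comp.
Qed.

Lemma orbit_sym x y : orbit x y -> orbit y x.
Proof.
by move=> [f df <-]; have [h dh fK] := displacement_inv df; exists h.
Qed.

Lemma orbit_eq x y : orbit x y -> orbit x = orbit y.
Proof.
move=> xy; apply/seteqP; split=> z.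
- move=> [f df <-]; apply: orbit_displacement => //; exact: orbit_sym.
- by move=> [f df <-]; exact: orbit_displacement.
Qed.

(** The restrictions of the displacements to an orbit commute and act on it
    transitively, so they are the translations of a group structure. *)
Lemma orbit_zmodule (e : X) :
  exists g : GRing.Zmodule (set_type (orbit e)),
    \val (0 : zmod_of g) = e /\
    forall f (x y : zmod_of g), displacement f -> \val y = f e ->
      f (\val x) = \val (x + y).
Proof.
pose T := set_type (orbit e).
pose e0 : T := SigSub (mem_set (orbit_refl e)).
pose restr f (df : displacement f) (x : T) : T :=
  SigSub (mem_set (orbit_displacement df (set_valP x))).
pose M : set (T -> T) :=
  [set k | exists2 f, displacement f & forall x, \val (k x) = f (\val x)].
have restrM f (df : displacement f) : M (restr f df) by exists f.
have [|x|k [f df kf]|g [g0 gP]] := @regular_action_zmodule T e0 M.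
- move=> k l x [f df kf] [h dh lh]; apply: val_inj.
  by rewrite kf lh lh kf displacement_comm.
- by have [f df fe] := set_valP x; exists (restr f df) => //; exact: val_inj.
- have [h dh fK] := displacement_inv df.
  exists (restr h dh e0); apply: val_inj.
  by rewrite kf /= displacement_comm // fK.
exists g; split=> [|f x y df yE]; first by rewrite g0.
transitivity (\val (restr f df x)) => //; rewrite (gP _ _ (restrM f df)).
by congr (\val (_ + _ : zmod_of g)); exact: val_inj.
Qed.

End DistributiveSolution.

Theorem theorem7p8 (X : Type) (sigma tau : X -> X -> X)
    (hsol : is_solution sigma tau) (hdist : is_distributive sigma tau) :
  exists (I : Type) (A : I -> set X)
         (g : forall j : I, GRing.Zmodule (set_type (A j)))
         (a : forall i j : I, zmod_of (g j)),
    [/\ partition [set: I] A [set: X],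
        forall j : I,
          subgroup_generated [set a i j | i in [set: I]] = [set: zmod_of (g j)]
      & forall (i j : I) (x : zmod_of (g i)) (y : zmod_of (g j)),
          sigma (\val x) (\val y) = \val (y + a i j) /\
          tau (\val x) (\val y) = \val (x - a j i)].
Proof.
pose I := {O : set X | exists e, O = orbit sigma tau e}.
pose A (j : I) := sval j.
pose cls (x : X) : I := exist _ (orbit sigma tau x) (ex_intro _ x erefl).
have [b bP0] := choice (fun j : I => svalP j).
have bP j : A j = orbit sigma tau (b j) by exact: bP0.
have AP (j : I) : exists g : GRing.Zmodule (set_type (A j)),
    \val (0 : zmod_of g) = b j /\
    forall f (x y : zmod_of g), displacement sigma tau f -> \val y = f (b j) ->
      f (\val x) = \val (x + y).
  by rewrite bP; exact: orbit_zmodule.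
pose g j := projT1 (cid (AP j)).
have g0 j : \val (0 : zmod_of (g j)) = b j.
  by rewrite /g; case: cid => ? [].
have gP j f (x y : zmod_of (g j)) : displacement sigma tau f ->
    \val y = f (b j) -> f (\val x) = \val (x + y).
  by rewrite /g; case: cid x y => ? [_ +] x y /=; apply.
(* On A_i every sigma_x equals sigma_(b_i), and it is the translation of A_j by
   its value at the base point b_j. *)
have aP i j : A j (sigma (b i) (b j)).
  rewrite bP; apply: orbit_displacement; last exact: orbit_refl.
  exact: displacement_sigma.
pose a i j : zmod_of (g j) := SigSub (mem_set (aP i j)).
have sigma_base (i : I) x : A i x -> sigma x = sigma (b i).
  by rewrite bP => -[f df <-]; exact: sigma_displacement df.
have sigmaE (i j : I) x (y : zmod_of (g j)) : A i x ->
    sigma x (\val y) = \val (y + a i j).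
  move=> /sigma_base ->; apply: gP => //; exact: displacement_sigma.
have tauE (i j : I) x (y : zmod_of (g j)) : A i x ->
    tau (\val y) x = \val (y - a i j).
  move=> Ax; rewrite -{1}(subrK (a i j) y) -(sigmaE i j x) //.
  exact: (sigmaK hsol hdist).
have clsP x : A (cls x) x by exact: orbit_refl.
exists I, A, g, a; split.
- split.
  + by apply/seteqP; split=> // x _; exists (cls x).
  + move=> i j _ _ [x []]; rewrite !bP => ix jx.
    suff : A i = A j by case: (i) (j) => [? ?] [? ?]; exact: eq_exist.
    by rewrite !bP (orbit_eq hsol hdist ix) (orbit_eq hsol hdist jx).
  + by move=> i _; exists (b i); rewrite bP; exact: orbit_refl.
- move=> j; apply/seteqP; split=> // y _ H [Hzmod Ha].
  have [H0 HB] := Hzmod.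
  have HaE i : H (a i j) by apply: Ha; exists i.
  (* Each generator of the displacements adds or subtracts some a_(i,j), so H is
     stable under all of them; it contains the base point 0, hence its orbit. *)
  have stable f : displacement sigma tau f -> forall z : zmod_of (g j), H z ->
      exists2 t : zmod_of (g j), H t & \val t = f (\val z).
    elim=> [|x|x|f1 f2 _ IH1 _ IH2] z Hz.
    * by exists z.
    * exists (z + a (cls x) j); last by rewrite (sigmaE (cls x)).
      apply/set_mem; apply: (GRing.zmod_closedD Hzmod).2; exact: mem_set.
    * exists (z - a (cls x) j); last by rewrite -(tauE (cls x) j x).
      by apply/set_mem; apply: HB; exact: mem_set.
    * have [t Ht tE] := IH2 z Hz; have [u Hu uE] := IH1 t Ht.
      by exists u; rewrite // uE tE.
  have := set_valP y; rewrite {1}bP => -[f df fE].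
  have [t Ht tE] := stable f df 0 (set_mem H0).
  suff -> : y = t by [].
  by apply: val_inj; rewrite tE g0.
- move=> i j x y; split; first by apply: sigmaE; exact: set_valP.
  by apply: tauE; exact: set_valP.
Qed.
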